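(* Let $G$ be a unicyclic graph with $n \ge 4$ vertices and maximum degree $\Delta \ge 3$, and let $f : [1,\infty) \to \mathbb{R}^+$ be a function such that $\log f$ is convex. Then $$ II_f(G) \ge f(\Delta)\, f(2)^{n-\Delta+1} f(1)^{\Delta-2}, $$ and the inequality is attained (i.e., equality holds) if and only if $G \in \mathcal{H}_n^\Delta$.
   Context: All graphs are finite, connected, simple (no loops, no multiple edges) and have at least one edge. A unicyclic graph is a graph containing exactly one cycle. For a vertex $u$ of $G$, $d_u$ denotes its degree. $\mathbb{R}^+$ denotes the positive real numbers. For a function $f:[1,\infty)\to\mathbb{R}^+$, $II_f(G) = \prod_{u\in V(G)} f(d_u)$. For $n\ge 4$ and $3\le \Delta\le n-1$, $\mathcal{H}_n^\Delta$ is the set of graphs (up to isomorphism) obtained from a cycle $C_k$, with $3\le k\le n-\Delta+2$, by attaching to one and the same vertex of the cycle $\Delta-2$ paths of lengths $m_1,\dots,m_{\Delta-2}\ge 1$ (each path having that cycle vertex as an end-vertex, and the paths being otherwise disjoint from each other and from the cycle), where $k+m_1+\dots+m_{\Delta-2}=n$. Equivalently, $\mathcal{H}_n^\Delta$ is the set of unicyclic graphs with $n$ vertices whose degree sequence is $(\Delta,2,\dots,2,1,\dots,1)$ with $n-\Delta+1$ entries equal to $2$ and $\Delta-2$ entries equal to $1$.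
   Formalization: The ''only if'' part of the equality case is stated for log f strictly convex; for merely convex log f it fails (f = 1, triangle with pendant edges at two different vertices). The inequality and the ''if'' part are kept for all convex log f. *)

(* Defs.v *)
From HB Require Import structures.
From mathcomp Require Import all_boot all_order all_algebra.
From mathcomp Require Import interval_inference.
From mathcomp Require Import all_classical all_reals.
From mathcomp Require Import topology normedtype convex exp.

Set Implicit Arguments.
Unset Strict Implicit.
Unset Printing Implicit Defensive.

Import Order.TTheory GRing.Theory Num.Theory.

Record sgraph := SGraph {
  vertex :> finType;
  edge : rel vertex;
  edge_sym : symmetric edge;
  edge_irrefl : irreflexive edge
}.

Arguments edge {s}.

Definition connected_graph (G : sgraph) : Prop :=
  0 < #|G| /\ forall x y : G, connect edge x y.

Definition deg (G : sgraph) (u : G) : nat := #|[set v | edge u v]|.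

Definition max_degree (G : sgraph) : nat := \max_(u : G) deg u.

Definition graph_iso (G H : sgraph) : Prop :=
  exists2 h : G -> H, bijective h & {mono h : x y / edge x y}.

Definition simple_cycle (G : sgraph) (c : seq G) : bool :=
  [&& 3 <= size c, uniq c & cycle edge c].

(* A cycle subgraph is determined by its edge set, whereas [c] also carries a
   base point and an orientation. *)
Definition cycle_edges (G : sgraph) (c : seq G) : {set {set G}} :=
  [set [set x; next c x] | x in c].

Definition is_cycle (G : sgraph) (C : {set {set G}}) : Prop :=
  exists2 c : seq G, simple_cycle c & C = cycle_edges c.

Definition unicyclic (G : sgraph) : Prop :=
  connected_graph G /\ exists! C : {set {set G}}, is_cycle C.

(* Cycle C_k (vertices [inl i]) with r paths attached at its vertex 0; the path
   number a has length m a, its vertices other than the attaching one being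
   [inr (Tagged _ j)] with tag a and [j : 'I_(m a)]. *)
Section CycleWithPaths.
Variables (k r : nat) (m : 'I_r -> nat).

Definition cwp_vertex : finType := ('I_k + {a : 'I_r & 'I_(m a)})%type.

Definition cwp_arc (x y : cwp_vertex) : bool :=
  match x, y with
  | inl i, inl j => j == i.+1 %% k :> nat
  | inl i, inr q => (i == 0 :> nat) && (tagged q == 0 :> nat)
  | inr p, inr q => (tag p == tag q) && (tagged q == (tagged p).+1 :> nat)
  | inr _, inl _ => false
  end.

Definition cwp_edge (x y : cwp_vertex) : bool :=
  (x != y) && (cwp_arc x y || cwp_arc y x).

Lemma cwp_edge_sym : symmetric cwp_edge.
Proof. by move=> x y; rewrite /cwp_edge eq_sym orbC. Qed.

Lemma cwp_edge_irrefl : irreflexive cwp_edge.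
Proof. by move=> x; rewrite /cwp_edge eqxx. Qed.

Definition cycle_with_paths : sgraph := SGraph cwp_edge_sym cwp_edge_irrefl.

End CycleWithPaths.

Definition in_H (n Delta : nat) (G : sgraph) : Prop :=
  exists (k : nat) (m : 'I_(Delta - 2) -> nat),
    [/\ 3 <= k <= n - Delta + 2,
        forall a, 1 <= m a,
        k + \sum_a m a = n
      & graph_iso G (cycle_with_paths k m)].

Local Open Scope ring_scope.

Definition II (R : realType) (f : R -> R) (G : sgraph) : R :=
  \prod_(u : G) f (deg u)%:R.

Local Open Scope convex_scope.

(* Strict counterpart of [convex_function] for real functions. *)
Definition strictly_convex_function (R : realType)
    (E' := convex_lmodType R^o) (D : set E') (f : E' -> R^o) : Prop :=
  forall t : {i01 R}, 0 < t%:num < 1 ->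
    {in D &, forall x y : E', x != y ->
      (f (x <| t |> y) < f x <| t |> f y)%R}.

(* Main.v *)
Require Import Defs.
From mathcomp Require Import all_boot all_order all_algebra.
From mathcomp Require Import interval_inference.
From mathcomp Require Import all_classical all_reals.
From mathcomp Require Import topology normedtype convex exp.
From mathcomp Require Import zify ring lra.

Import Order.TTheory GRing.Theory Num.Theory.

(** A unicyclic graph is a functional graph: turning around the cycle, and
    walking towards it elsewhere, defines a map phi whose arcs x -> phi x are
    exactly the edges, each counted once.  Hence the degrees sum to 2n, and
    deg u - 1 is the number of preimages of u.  Since log f lies above the line
    through its values at 1 and 2, summing the gaps to this line over all
    vertices but one of degree Delta gives the bound, and equality in the
    strictly convex case forces all other degrees to be at most 2.  Then phi is
    injective away from the preimages of the vertex u0 of degree Delta, so u0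
    is on the cycle and a vertex off the cycle is determined by its distance to
    u0 and by the last vertex visited before u0. *)

(** * Unicyclic graphs as functional graphs *)

Lemma next_last (T : eqType) (y : T) (p : seq T) :
  uniq (y :: p) -> next (y :: p) (last y p) = y.
Proof.
by move=> Up; rewrite next_nth mem_last index_last // nth_default.
Qed.

Lemma next_next_neq (T : eqType) (c : seq T) (x : T) :
  uniq c -> 3 <= size c -> x \in c -> next c (next c x) != x.
Proof.
move=> Uc c3 xc; have [i s def_c] := rot_to xc.
rewrite -!(next_rot i Uc) def_c.
have: uniq (x :: s) by rewrite -def_c rot_uniq.
have: 3 <= size (x :: s) by rewrite -def_c size_rot.
case: s {def_c} => [|y [|z s]] //= _; rewrite !inE !negb_or !eqxx.
by case/andP=> /and3P[xy xz _] _; rewrite [y == x]eq_sym (negPf xy) eq_sym.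
Qed.

(** A duplicate-free [S]-path from [y] to [x] is closed by the edge from [x] to [y]. It has at least
    three vertices: with one, the edge would be a loop; with two, [S x y] would hold. *)
Lemma cycle_through_edge {G : sgraph} (S : rel G) (x y : G) :
  subrel S edge -> symmetric S -> connect S y x -> edge x y -> ~~ S x y ->
  exists2 c : seq G, simple_cycle c & [set x; y] \in cycle_edges c.
Proof.
move=> Se Ssym /connectP[p0 p0P x_last] exy nSxy.
move: x_last; case/shortenP: p0P => p pP Up _ x_last.
exists (y :: p); last first.
  by apply/imsetP; exists x; rewrite x_last ?next_last ?mem_last.
apply/and3P; split=> //; last first.
  by rewrite /= rcons_path -x_last exy andbT (sub_path Se).
case: p {Up} pP x_last => [|z [|z' p]] //=.
  by move=> _ xy; rewrite xy edge_irrefl in exy.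
by rewrite andbT => Syz xz; rewrite xz Ssym Syz in nSxy.
Qed.

(** An edge outside [S] would lie on a cycle. By uniqueness this cycle has the same edges as [c],
    and those all lie in [S]. *)
Lemma unicyclic_edge_sub {G : sgraph} (c : seq G) (S : rel G) :
  unicyclic G -> simple_cycle c -> subrel S edge -> symmetric S ->
  (forall x y, connect S x y) -> {in c, forall x, S x (next c x)} ->
  subrel edge S.
Proof.
move=> [_ [C [_ Cuniq]]] cC Se Ssym Scon Sc x y exy.
apply: contraT => nSxy.
have [c' c'C] := cycle_through_edge S x y Se Ssym (Scon y x) exy nSxy.
have -> : cycle_edges c' = cycle_edges c.
  by rewrite -(Cuniq _ (ex_intro2 _ _ c cC erefl)) (Cuniq _ (ex_intro2 _ _ c' c'C erefl)).
case/imsetP=> z zc /setP xyz.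
have xNy: x != y by apply: contraTneq exy => ->; rewrite edge_irrefl.
move: (xyz x) (xyz y) nSxy xNy; rewrite !inE !eqxx orbT /=.
case: (eqVneq x z) => [-> _|_ /esym/eqP ->]; case: (eqVneq y z) => [->|_].
- by [].
- by move=> /esym/eqP ->; rewrite Sc.
- by rewrite Ssym Sc.
- by move=> /esym/eqP ->; rewrite eqxx.
Qed.

(** Take for [d] the distance to [c] and for [p x] the first step of a shortest walk from [x] to
    [c]. *)
Lemma descending_map {G : sgraph} (c : seq G) :
  connected_graph G -> 0 < size c ->
  exists (d : G -> nat) (p : G -> G),
    {in [predC c], forall x, edge x (p x) /\ d (p x) < d x}.
Proof.
move=> [_ Gcon]; case: c => // x0 c _; set C := x0 :: c.
pose D x n := [exists q : n.-tuple G, path edge x q && (last x q \in C)].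
have Dex x : exists n, D x n.
  have /connectP[q qP q_last] := Gcon x x0.
  exists (size q); apply/existsP; exists (in_tuple q) => /=.
  by rewrite qP -q_last mem_head.
pose d x := ex_minn (Dex x).
have dmin x n : D x n -> d x <= n by rewrite /d; case: ex_minnP => m _; apply.
suff /choice[p pP] x : exists y, x \notin C -> edge x y /\ d y < d x.
  by exists d, p => x; rewrite inE; apply: pP.
have [xC|xNC] := boolP (x \in C); first by exists x.
have: D x (d x) by rewrite /d; case: ex_minnP.
case/existsP=> -[q /= /eqP sq] /andP[].
case: q sq => [|y q] /= sq; first by move=> _ xC; rewrite xC in xNC.
case/andP=> exy yq q_last; exists y => _; split=> //.
rewrite -sq ltnS; apply: dmin; apply/existsP.
by exists (in_tuple q); rewrite /= yq.
Qed.

(** With [phi] equal to [next c] on the cycle and to [p] elsewhere, the arcs of [phi] form a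
    connected spanning subgraph containing the cycle, hence all of [G]. That [phi] has no 2-cycle
    means that no edge comes from two arcs. *)
Lemma unicyclic_functional {G : sgraph} :
  unicyclic G -> exists (c : seq G) (phi : G -> G),
  [/\ simple_cycle c,
      {in c, forall x, phi x = next c x},
      forall x, exists n, iter n phi x \in c,
      forall x, phi (phi x) != x
    & forall x y, edge x y = (y == phi x) || (x == phi y)].
Proof.
move=> uG; have [Gcon [_ [[c cC _] _]]] := uG.
have /and3P[c3 Uc cP] := cC.
have [d [p pP]] := descending_map c Gcon (ltn_trans (isT : 0 < 2) c3).
pose phi x := if x \in c then next c x else p x.
have phi_c : {in c, forall x, phi x = next c x} by move=> x xc; rewrite /phi xc.
have phi_edge x : edge x (phi x).
  rewrite /phi; case: ifPn => xc; first exact: next_cycle.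
  by have [] := pP x xc.
have reach x : exists n, iter n phi x \in c.
  have [n] := ubnP (d x); elim: n => // n IHn in x *; rewrite ltnS => dx.
  have [xc|xc] := boolP (x \in c); first by exists 0.
  have [_ dpx] := pP x xc.
  have [m] := IHn (p x) (leq_trans dpx dx).
  by exists m.+1; rewrite iterSr /phi (negPf xc).
have phi2 x : phi (phi x) != x.
  have [xc|xc] := boolP (x \in c).
    by rewrite (phi_c x) // phi_c ?mem_next // next_next_neq.
  rewrite /phi (negPf xc); have [_ dpx] := pP x xc.
  (* If [p x] is on the cycle then so is its image, unlike [x]; otherwise [d] drops twice. *)
  case: ifPn => pxc; first by apply: contraNneq xc => <-; rewrite mem_next.
  have [_ dppx] := pP _ pxc.
  by apply: contraTneq (ltn_trans dppx dpx) => ->; rewrite ltnn.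
exists c, phi; split=> //.
pose S x y := (y == phi x) || (x == phi y).
have Ssym : symmetric S by move=> x y; rewrite /S orbC.
have Se : subrel S edge.
  by move=> x y /orP[] /eqP ->; rewrite // edge_sym.
have Sphi x : S x (phi x) by rewrite /S eqxx.
have conS : connect_sym S by exact: sym_connect_sym.
have con_iter n x : connect S x (iter n phi x).
  elim: n => [|n IHn]; first exact: connect0.
  by apply: connect_trans IHn (connect1 _); apply: Sphi.
have con_c x y : x \in c -> y \in c -> connect S x y.
  move=> xc yc; suff : cycle S c by move/connect_cycle; apply.
  have nextS : {in c, forall x, S x (next c x)}.
    by move=> z zc; rewrite -phi_c.
  exact: cycle_from_next.
have Scon x y : connect S x y.
  have [n xn] := reach x; have [m ym] := reach y.
  apply: connect_trans (con_iter n x) _.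
  apply: connect_trans (con_c _ _ xn ym) _.
  by rewrite conS con_iter.
move=> x y; apply/idP/idP; last exact: Se.
apply: (unicyclic_edge_sub c S) => // z zc; by rewrite -phi_c.
Qed.

(** * Degrees as fiber sizes, and their sum *)

Lemma deg_functional {G : sgraph} (phi : G -> G) (u : G) :
  (forall x, phi (phi x) != x) ->
  (forall x y : G, edge x y = (y == phi x) || (x == phi y)) ->
  deg u = #|[set v | phi v == u]|.+1.
Proof.
move=> phi2 edgeE; rewrite /deg.
have -> : [set v | edge u v] = phi u |: [set v | phi v == u].
  by apply/setP=> v; rewrite !inE edgeE [u == _]eq_sym.
by rewrite cardsU1 inE phi2.
Qed.

Lemma sum_card_fibers {T : finType} (phi : T -> T) :
  \sum_u #|[set v | phi v == u]| = #|T|.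
Proof.
rewrite -[RHS]sum1_card [RHS](partition_big phi xpredT) //=.
by apply: eq_bigr => u _; rewrite -sum1_card; apply: eq_bigl => v; rewrite inE.
Qed.

Lemma unicyclic_sum_deg {G : sgraph} :
  unicyclic G -> \sum_(u : G) deg u = #|G|.*2.
Proof.
move=> /unicyclic_functional[c [phi [_ _ _ phi2 edgeE]]].
under eq_bigr => u _ do rewrite (deg_functional phi) // -addn1.
by rewrite big_split /= sum_card_fibers sum1_card addnn.
Qed.

Lemma unicyclic_deg_gt0 {G : sgraph} (u : G) : unicyclic G -> 0 < deg u.
Proof.
move=> /unicyclic_functional[c [phi [_ _ _ phi2 edgeE]]].
by rewrite (deg_functional phi).
Qed.

(** * Degrees in a cycle with paths attached at one vertex *)

Lemma deg_iso {G H : sgraph} (h : G -> H) (u : G) :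
  bijective h -> {mono h : x y / edge x y} -> deg (h u) = deg u.
Proof.
move=> hb hm; rewrite /deg -(card_imset _ (bij_inj hb)).
congr #|pred_of_set _|; apply/setP=> v; rewrite inE.
have [g hK gK] := hb.
by rewrite -[v]gK hm (mem_imset _ _ (bij_inj hb)) inE.
Qed.

(** Away from the hub [inl 0], a vertex has at most one outgoing and at most one incoming arc. *)
Lemma cwp_deg_le2 (k r : nat) (m : 'I_r -> nat) (x : cwp_vertex k m) :
  (if x is inl i then i != 0 :> nat else true) ->
  @deg (cycle_with_paths k m) x <= 2.
Proof.
move=> xN0; rewrite /deg.
apply: (@leq_trans (#|[set y | @cwp_arc k r m x y]| + #|[set y | @cwp_arc k r m y x]|)).
  apply: leq_trans (leq_card_setU _ _); apply/subset_leq_card/fintype.subsetP=> y.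
  by rewrite !inE /= /cwp_edge => /andP[].
have tag_inj (p q : {a : 'I_r & 'I_(m a)}) :
    tag p = tag q -> tagged p = tagged q :> nat -> p = q.
  case: p q => [a i] [b j] /= ab; subst b => ij.
  by congr existT; apply: val_inj.
apply: (@leq_add _ _ 1 1); apply/card_le1_eqP=> y y'; rewrite !inE.
  case: x xN0 => [i|p] iN0; case: y => [j|q] //; case: y' => [j'|q'] //=.
  - by move=> /eqP ej /eqP ej'; congr inl; apply: val_inj; rewrite /= ej ej'.
  - by rewrite (negPf iN0).
  - by rewrite (negPf iN0).
  - by rewrite (negPf iN0).
  move=> /andP[/eqP t1 /eqP v1] /andP[/eqP t2 /eqP v2].
  by congr inr; apply: tag_inj; rewrite -?t1 -?t2 ?v1 ?v2.
case: x xN0 => [i|p] iN0; case: y => [j|q] //; case: y' => [j'|q'] //=.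
- move=> /eqP ej /eqP ej'; congr inl; apply: (can_inj (@ordSK _)).
  by apply: val_inj; rewrite /= -ej -ej'.
- move=> /andP[/eqP j0 _] /andP[/eqP j0' _].
  by congr inl; apply: val_inj; rewrite /= j0 j0'.
- by move=> /andP[_ /eqP ->] /andP[_ /eqP].
- by move=> /andP[_ /eqP v1] /andP[_ /eqP v2]; rewrite v2 in v1.
move=> /andP[/eqP t1 /eqP v1] /andP[/eqP t2 /eqP v2].
by congr inr; apply: tag_inj; [rewrite t1 t2 | move: v1; rewrite v2 => -[]].
Qed.

Lemma in_H_deg_le2 {G : sgraph} (n Delta : nat) (u0 : G) :
  in_H n Delta G -> 3 <= deg u0 -> forall u, u != u0 -> deg u <= 2.
Proof.
move=> [k [m [/andP[k3 _] _ _ [h hb hm]]]] u0_3.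
have only_hub u : 3 <= deg u -> if h u is inl i then i = 0 :> nat else False.
  rewrite -(deg_iso h) // ltnNge; case hu: (h u) => [i|q].
    by move=> hN; apply/eqP; apply: contraNT hN; exact: (cwp_deg_le2 k _ m (inl i)).
  by rewrite (cwp_deg_le2 k _ m (inr q)).
move=> u; rewrite leqNgt; apply: contraNN => u3.
move: (only_hub _ u3) (only_hub _ u0_3).
case hu: (h u) => [i|//]; case hu0: (h u0) => [j|//] i0 j0.
by apply/eqP/(bij_inj hb); rewrite hu hu0; congr inl; apply: val_inj; rewrite /= i0 j0.
Qed.

(** * Recovering the cycle and the paths from the degrees *)

Lemma index_next {T : eqType} (c : seq T) (x : T) :
  uniq c -> x \in c -> index (next c x) c = (index x c).+1 %% size c.
Proof.
move=> Uc xc; rewrite next_nth xc; case: c Uc xc => // y p Uc xc.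
have: index x (y :: p) < size (y :: p) by rewrite index_mem.
set i := index x (y :: p); rewrite ltnS leq_eqVlt => /predU1P[-> | ip].
  by rewrite nth_default // modnn /= eqxx.
rewrite modn_small ?ltnS // -[nth y p i]/(nth y (y :: p) i.+1) index_uniq //.
Qed.

(** The depth is the least number of steps of [phi] needed to reach [C]; the recursive equation is
    the form used for descent. *)
Lemma depth_exists {T : Type} (phi : T -> T) (C : pred T) :
  (forall x, exists n, C (iter n phi x)) ->
  exists d : T -> nat, forall x, d x = if C x then 0 else (d (phi x)).+1.
Proof.
move=> reach; exists (fun x => ex_minn (reach x)) => x.
case: ex_minnP => n nC nmin; case: ex_minnP => m mC mmin.
case: ifPn => [xC|xNC]; first by apply/eqP; rewrite -leqn0 nmin.
case: n nC nmin => [|n] nC nmin; first by rewrite nC in xNC.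
apply/eqP; rewrite eqn_leq nmin ?iterSr //= ltnS mmin //.
by rewrite -iterSr.
Qed.

(** The isomorphism sends a cycle vertex to its index counted from [u0], and any other vertex [x] to
    position [d x - 1] on the path labelled by [top x], the last vertex off the cycle on its way to
    [u0]. *)
Lemma in_H_of_deg_le2 {G : sgraph} (u0 : G) :
  unicyclic G -> 3 <= deg u0 -> (forall u, u != u0 -> deg u <= 2) ->
  in_H #|G| (deg u0) G.
Proof.
move=> /unicyclic_functional[c0 [phi [c0C phi_c0 reach0 phi2 edgeE]]] u0_3 deg_le2.
have /and3P[k0_3 Uc0 _] := c0C.
have degE u := deg_functional phi u phi2 edgeE.
have phi_inj u v w : u != u0 -> phi v = u -> phi w = u -> v = w.
  move=> /deg_le2; rewrite degE ltnS => /card_le1_eqP inj vu wu.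
  by apply: inj; rewrite !inE ?vu ?wu.
have phi_in x : x \in c0 -> phi x \in c0 by move=> xc; rewrite phi_c0 // mem_next.
(* At a cycle vertex other than [u0], the only preimage is the predecessor on the cycle. *)
have enters_u0 x : x \notin c0 -> phi x \in c0 -> phi x = u0.
  move=> xc pxc; apply/eqP; apply: contraNT xc => pxN.
  rewrite (phi_inj _ x (prev c0 (phi x)) pxN) ?mem_prev //.
  by rewrite phi_c0 ?mem_prev // next_prev.
(* If [u0] were off the cycle, its orbit could never enter it, since the only possible entry point
   is [u0] itself. *)
have u0c0 : u0 \in c0.
  have [n] := reach0 u0; apply: contraLR => u0c; elim: n => [//|n IHn] /=.
  by apply/negP=> nc; move: (nc); rewrite (enters_u0 _ IHn nc) (negPf u0c).
(* Rotating the cycle gives [u0] index 0, the place of the hub in the model. *)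
have [i s def_c] := rot_to u0c0; set c := u0 :: s in def_c.
have memc x : (x \in c) = (x \in c0) by rewrite -def_c mem_rot.
have Uc : uniq c by rewrite -def_c rot_uniq.
have k3 : 3 <= size c by rewrite -def_c size_rot.
have phi_c x : x \in c -> phi x = next c x.
  by rewrite memc => xc; rewrite -def_c next_rot // phi_c0.
have {}enters_u0 x : x \notin c -> phi x \in c -> phi x = u0.
  by rewrite !memc; apply: enters_u0.
have {}phi_in x : x \in c -> phi x \in c by rewrite !memc; apply: phi_in.
have u0c : u0 \in c by rewrite memc.
have index_u0 x : (index x c == 0) = (x == u0).
  by rewrite /c /= [x == u0]eq_sym; case: (u0 == x).
clearbody c.
have [|d dE] := depth_exists phi (mem c).
  by move=> x; have [n nc] := reach0 x; exists n; rewrite /= memc.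
have d0 x : (d x == 0) = (x \in c) by rewrite dE /=; case: ifP.
have dS x : x \notin c -> d x = (d (phi x)).+1 by rewrite dE /= => /negPf ->.
pose top x := iter (d x).-1 phi x.
have top_id x : x \notin c -> phi x \in c -> top x = x.
  by move=> xc; rewrite /top dS // -d0 => /eqP ->.
have top_phi x : x \notin c -> phi x \notin c -> top x = top (phi x).
  by move=> xc pxc; rewrite /top (dS x) //= dS // iterSr.
have top_ind (P : G -> Prop) :
    (forall x, x \notin c -> phi x \in c -> P x) ->
    (forall x, x \notin c -> phi x \notin c -> P (phi x) -> P x) ->
    forall x, x \notin c -> P x.
  move=> P1 P2 x; have [n] := ubnP (d x); elim: n x => // n IHn x dx xc.
  have [pxc|pxc] := boolP (phi x \in c); first exact: P1.
  by apply: P2 => //; apply: IHn => //; rewrite -ltnS -dS.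
pose A := [set a | (a \notin c) && (phi a == u0)].
have topA x : x \notin c -> top x \in A.
  move: x; apply: top_ind => x xc pxc; last by rewrite (top_phi x).
  by rewrite top_id // inE xc enters_u0 ?eqxx.
(* Both vertices are pushed one step towards the cycle; [phi] is injective over [phi x], which is
   off the cycle and so differs from [u0]. *)
have top_d_inj x y : x \notin c -> y \notin c -> top x = top y -> d x = d y -> x = y.
  move=> xc; move: x xc y; apply: top_ind => x xc pxc => [|IHx] y yc.
    rewrite (top_id x) // (dS x) // (dS y) // => xt [] dxy.
    by rewrite xt top_id // -d0 -dxy d0.
  rewrite (dS x) // (dS y) // => txy [] dxy.
  have pyc : phi y \notin c by rewrite -d0 -dxy d0.
  have pxy : phi x = phi y by apply: IHx; rewrite -?top_phi.
  apply: (phi_inj (phi x)) => //; by apply: contraNneq pxc => ->.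
pose branch a := [set x | (x \notin c) && (top x == a)].
(* The vertices from [x] to [top x] along [phi] lie in one branch and have distinct depths, the
   largest being [d x]. Hence [d x - 1] is a valid position on a path of length
   [#|branch (top x)|]. *)
have depth_le_branch x : x \notin c -> d x <= #|branch (top x)|.
  move=> xc; suff : d x <= #|[set y in branch (top x) | d y <= d x]|.
    by move/leq_trans; apply; apply/subset_leq_card/fintype.subsetP=> y; rewrite !inE => /andP[].
  move: x xc; apply: top_ind => x xc pxc => [|IHx].
    rewrite {1}dS //; move: (pxc); rewrite -d0 => /eqP ->.
    by apply/card_gt0P; exists x; rewrite !inE xc eqxx leqnn.
  set B := [set y in _ | _] in IHx; have xB : x \notin B.
    by rewrite !inE (dS x) // ltnn andbF.
  rewrite {1}dS //; apply: (@leq_trans #|x |: B|); first by rewrite cardsU1 xB.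
  apply/subset_leq_card/fintype.subsetP=> y; rewrite !inE => /orP[/eqP ->|].
    by rewrite xc eqxx leqnn.
  by rewrite -top_phi // (dS x) // => /andP[-> /leqW].
(* Two neighbours of [u0] are on the cycle: its image and its predecessor. The others are the
   elements of [A], one for each path. *)
have cardA : deg u0 - 2 = #|A|.
  rewrite degE (_ : [set v | phi v == u0] = prev c u0 |: A).
    by rewrite cardsU1 inE mem_prev u0c /= subn2.
  apply/setP=> v; rewrite inE in_setU1 [v \in A]inE; have [vc|vc] /= := boolP (v \in c).
    rewrite orbF phi_c //; apply/eqP/eqP => [<-|->]; first by rewrite prev_next.
    by rewrite next_prev.
  by case: (v =P _) => // e; rewrite e mem_prev u0c in vc.
have sum_branch : \sum_(a in A) #|branch a| = #|[predC c]|.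
  rewrite -[RHS]sum1_card [RHS](partition_big top (mem A)) => [|x xc]; last exact: topA.
  by apply: eq_bigr => a _; rewrite -sum1_card; apply: eq_bigl => x; rewrite !inE.
have cardG : size c + \sum_(a in A) #|branch a| = #|G|.
  by rewrite sum_branch -(card_uniqP Uc) cardC.
have branch_gt0 a : a \in A -> 0 < #|branch a|.
  rewrite inE => /andP[ac /eqP pa]; apply/card_gt0P; exists a.
  by rewrite inE ac top_id ?pa ?eqxx.
have kG : size c <= #|G| - deg u0 + 2.
  have : #|A| <= \sum_(a in A) #|branch a|.
    by rewrite -sum1_card; apply: leq_sum.
  by rewrite -cardA; lia.
pose m (a : 'I_#|A|) := #|branch (enum_val a)|.
have sum_m : \sum_a m a = \sum_(a in A) #|branch a|.
  by rewrite (big_enum_val (fun a => #|branch a|)).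
rewrite /in_H cardA; exists (size c), m; split.
- by rewrite k3.
- by move=> a; apply/branch_gt0/enum_valP.
- by rewrite sum_m.
pose spec x (v : cwp_vertex (size c) m) := match v with
  | inl i => x \in c /\ i = index x c :> nat
  | inr q => [/\ x \notin c, enum_val (tag q) = top x & (tagged q).+1 = d x]
  end.
have /choice[h hP] x : exists v, spec x v.
  have [xc|xc] := boolP (x \in c).
    by exists (inl (Ordinal (etrans (index_mem x c) xc))).
  pose a := enum_rank_in (topA x xc) (top x).
  have aE : enum_val a = top x by rewrite enum_rankK_in ?topA.
  have dm : (d x).-1 < m a by rewrite /m aE dS // -dS // depth_le_branch.
  by exists (inr (Tagged (fun a => 'I_(m a)) (Ordinal dm))); split; rewrite //= dS.
have h_inj : injective h.
  move=> x y hxy; move: (hP x) (hP y); rewrite hxy.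
  case: (h y) => [j [xc jx] [yc jy]|q [xc tx dx] [yc ty dy]].
    by rewrite -(nth_index u0 xc) -jx jy nth_index.
  by apply: top_d_inj; rewrite // -?tx -?dx.
exists h.
  (* Surjectivity comes from counting: the model has [size c] vertices plus the sizes of all
     branches, which is [#|G|]. *)
  apply: (inj_card_bij h_inj).
  rewrite card_sum card_ord card_tagged sumnE big_map big_enum /=.
  by under eq_bigr => a _ do rewrite card_ord; rewrite sum_m cardG.
move=> x y /=; rewrite /cwp_edge (inj_eq h_inj) edgeE.
(* Model arcs follow [phi] on the cycle but run against it on the paths, which are numbered from the
   hub outwards. *)
have arc_cc a b : a \in c -> b \in c ->
    (index b c == (index a c).+1 %% size c) = (b == phi a).
  move=> ac bc; rewrite phi_c // -index_next //; apply/eqP/eqP => [|-> //].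
  by move/(congr1 (nth u0 c)); rewrite !nth_index ?mem_next.
have arc_ct a b dq : a \in c -> b \notin c -> dq.+1 = d b ->
    (index a c == 0) && (dq == 0) = (a == phi b).
  move=> ac bc; rewrite (dS b) // => -[->]; rewrite d0 index_u0.
  apply/andP/eqP => [[/eqP -> /(enters_u0 b bc) -> //]|e].
  by rewrite -(enters_u0 b bc) -?e // eqxx.
have arc_tt a b (p q : {a : 'I_#|A| & 'I_(m a)}) :
    spec a (inr p) -> spec b (inr q) ->
    (tag p == tag q) && (tagged q == (tagged p).+1 :> nat) = (a == phi b).
  move=> [ac ta da] [bc tb db]; rewrite -(inj_eq enum_val_inj) ta tb.
  rewrite -eqSS da db (dS b) // eqSS; apply/andP/eqP => [[/eqP tab /eqP dab]|e].
    have pbc : phi b \notin c by rewrite -d0 dab d0.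
    by apply: top_d_inj; rewrite // -?top_phi.
  by rewrite (top_phi b) -?e.
have phi_cN a b : a \in c -> b \notin c -> (b == phi a) = false.
  by move=> ac; apply: contraNF => /eqP ->; apply: phi_in.
have phi1 z : z != phi z.
  by apply: contraNneq (phi2 z) => e; rewrite -!e.
case: (eqVneq x y) => [-> /=|_ /=]; first by rewrite orbb (negPf (phi1 y)).
have := hP x; have := hP y.
case: (h x) (h y) => [i1|p] [j|q].
- by move=> [yc jy] [xc ix] /=; rewrite ix jy !arc_cc.
- move=> [yc ty dy] [xc ix] /=; rewrite ix (arc_ct x y) // orbF.
  by rewrite (phi_cN x y).
- move=> [yc jy] [xc tx dx] /=; rewrite jy (arc_ct y x) //.
  by rewrite (phi_cN y x) // orbF.
by move=> yq xp; rewrite /= (arc_tt x y) // (arc_tt y x) // orbC.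
Qed.

(** * Convexity: gaps above the secant line *)

Local Open Scope ring_scope.

Lemma ln_prod (R : realType) (I : finType) (F : I -> R) :
  (forall i, 0 < F i) -> ln (\prod_i F i) = \sum_i ln (F i).
Proof.
move=> F0; suff [] : 0 < \prod_i F i /\ ln (\prod_i F i) = \sum_i ln (F i) by [].
elim/big_rec2: _ => [|i y x _ [x0 lnx]]; first by rewrite ltr01 ln1.
by rewrite mulr_gt0 // lnM ?posrE // lnx.
Qed.

(** Height of [g] at [d] above the line through its values at 1 and 2. *)
Definition secant_gap {R : realType} (g : R -> R) (d : nat) : R :=
  g d%:R - g 2 - (d%:R - 2) * (g 2 - g 1).

Lemma secant_gap_eq0 (R : realType) (g : R -> R) (d : nat) :
  (0 < d <= 2)%N -> secant_gap g d = 0.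
Proof.
by rewrite /secant_gap; case: d => [|[|[|]]] //= _; ring.
Qed.

(* 2 is the barycenter of 1 and d with weights (d-2)/(d-1) and 1/(d-1). *)
Lemma two_barycenter (R : realType) (d : nat) : (3 <= d)%N ->
  exists2 t : {i01 R}, 0 < t%:num < 1 &
    forall a b : R, conv t (a : R^o) (b : R^o) =
      ((d%:R - 2) * a + b) / (d%:R - 1).
Proof.
move=> d3; have d3R : 3 <= d%:R :> R by rewrite ler_nat.
pose w : R := (d%:R - 2) / (d%:R - 1).
have w0 : 0 < w by rewrite divr_gt0; lra.
have w1 : w < 1 by rewrite ltr_pdivrMr; lra.
exists (Itv01 (ltW w0) (ltW w1)); first by rewrite /= w0.
move=> a b; rewrite convRE /= /unstable.onem /w; field; lra.
Qed.

Lemma secant_gap_ge0 (R : realType) (g : R -> R) (d : nat) :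
  convex_function (`[1, +oo[%classic : set R^o) g -> (0 < d)%N ->
  0 <= secant_gap g d.
Proof.
move=> cg d0; have [d2|d3] := leqP d 2; first by rewrite secant_gap_eq0 ?d0.
have d3R : 3 <= d%:R :> R by rewrite ler_nat.
have [t _ tE] := two_barycenter R d d3.
have two : conv t (1 : R^o) (d%:R : R^o) = 2 by rewrite tE; field; lra.
have : g 2 <= conv t (g 1 : R^o) (g d%:R : R^o).
  by rewrite -two; apply: cg; rewrite inE /= in_itv /= andbT // ler1n.
by rewrite tE ler_pdivlMr /secant_gap; lra.
Qed.

Lemma secant_gap_gt0 (R : realType) (g : R -> R) (d : nat) :
  strictly_convex_function (`[1, +oo[%classic : set R^o) g -> (3 <= d)%N ->
  0 < secant_gap g d.
Proof.
move=> cg d3; have d3R : 3 <= d%:R :> R by rewrite ler_nat.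
have [t t01 tE] := two_barycenter R d d3.
have two : conv t (1 : R^o) (d%:R : R^o) = 2 by rewrite tE; field; lra.
have : g 2 < conv t (g 1 : R^o) (g d%:R : R^o).
  rewrite -two; apply: cg => //; rewrite ?inE /= ?in_itv /= ?andbT ?ler1n //.
    by lia.
  by rewrite lt_eqF //; lra.
by rewrite tE ltr_pdivlMr /secant_gap; lra.
Qed.

(** The values of [d] average 2, so the slope terms cancel in the sum of all gaps. The bounds on
    [d u0] make the natural subtractions exact. *)
Lemma sum_secant_gap {R : realType} (T : finType) (d : T -> nat) (g : R -> R) (u0 : T) :
  (\sum_u d u = #|T|.*2)%N -> (2 <= d u0 <= #|T|)%N ->
  \sum_u g (d u)%:R =
    g (d u0)%:R + g 2 *+ (#|T| - d u0 + 1) + g 1 *+ (d u0 - 2) +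
    \sum_(u | u != u0) secant_gap g (d u).
Proof.
move=> dsum /andP[d2 dn].
have gap_sum : \sum_u secant_gap g (d u) = \sum_u g (d u)%:R - g 2 *+ #|T|.
  rewrite /secant_gap sumrB big_split /= sumr_const -mulr_suml sumrB sumr_const.
  rewrite -natr_sum dsum -mulrnA mulnC muln2 subrr mul0r subr0; congr (_ + _).
  by rewrite mulNrn.
move: gap_sum; rewrite (bigD1 u0) //= /secant_gap -/(secant_gap _ _).
set S := \sum_(i | i != u0) _ => gap_sum.
have -> : \sum_u g (d u)%:R = g (d u0)%:R - g 2 - ((d u0)%:R - 2) * (g 2 - g 1) + S + g 2 *+ #|T|.
  by rewrite gap_sum subrK.
rewrite -[g 2 *+ (_ - _ + _)]mulr_natr -[g 1 *+ _]mulr_natr -mulr_natr natrD !natrB //.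
ring.
Qed.

(** * From the gaps to the bound and the equality case *)

Theorem theorem4p7 (R : realType) (G : sgraph) (n Delta : nat) (f : R -> R) :
  unicyclic G -> #|G| = n -> (4 <= n)%N ->
  max_degree G = Delta -> (3 <= Delta)%N ->
  (forall x : R, 1 <= x -> 0 < f x) ->
  convex_function (`[1, +oo[%classic : set R^o) (fun x : R => ln (f x)) ->
  let bound := f Delta%:R * f 2 ^+ (n - Delta + 1) * f 1 ^+ (Delta - 2) in
  [/\ II f G >= bound,
      in_H n Delta G -> II f G = bound
    & strictly_convex_function (`[1, +oo[%classic : set R^o)
        (fun x : R => ln (f x)) ->
      (II f G = bound <-> in_H n Delta G)].
Proof.
move=> uG Gn n4 maxD D3 fpos cf bound.
have G0 : (0 < #|G|)%N by rewrite Gn; lia.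
have [u0 u0D] := bigop.eq_bigmax (@deg G) G0.
have degu0 : deg u0 = Delta by rewrite -u0D.
have deg_gt0 (u : G) : (0 < deg u)%N := unicyclic_deg_gt0 u uG.
have fdeg (u : G) : 0 < f (deg u)%:R by rewrite fpos // ler1n.
have f1 : 0 < f 1 by rewrite fpos.
have f2 : 0 < f 2 by apply: fpos; rewrite ler1n.
have fD : 0 < f Delta%:R by rewrite -degu0.
have bound0 : 0 < bound by rewrite !mulr_gt0 ?exprn_gt0.
have II0 : 0 < II f G by rewrite /II prodr_gt0.
set g := fun x : R => ln (f x) in cf *.
pose rest := \sum_(u : G | u != u0) secant_gap g (deg u).
(* In logarithms, the excess over the bound is exactly the sum of the gaps away from [u0]. *)
have lnII : ln (II f G) = ln bound + rest.
  rewrite /II ln_prod // (sum_secant_gap G (@deg G) g u0) ?unicyclic_sum_deg //.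
    rewrite degu0 Gn !lnM ?posrE ?mulr_gt0 ?exprn_gt0 // !lnXn //.
  by rewrite degu0 (ltnW D3) -degu0 max_card.
have gap0 (u : G) : 0 <= secant_gap g (deg u) by apply: secant_gap_ge0.
have eqE : II f G = bound <-> rest = 0.
  split=> [e|e]; last by apply: ln_inj; rewrite ?posrE // lnII e addr0.
  by apply: (addrI (ln bound)); rewrite -lnII e addr0.
(* Every vertex other than [u0] has degree 1 or 2, where the gap vanishes. *)
have HE : in_H n Delta G -> II f G = bound.
  move=> GH; apply/eqE; apply: big1 => u uu0; apply: secant_gap_eq0.
  by rewrite deg_gt0 (in_H_deg_le2 _ _ _ GH _ _ uu0) // degu0.
split=> // [|scf].
  by rewrite -ler_ln ?posrE // lnII lerDl sumr_ge0.
(* A zero sum of nonnegative gaps makes each gap zero, while strict convexity makes it positive at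
   any degree from 3 on. *)
split=> [/eqE/eqP|//]; rewrite psumr_eq0 // => /allP gaps0.
rewrite -Gn -degu0; apply: in_H_of_deg_le2 => //; first by rewrite degu0.
move=> u uu0; rewrite leqNgt; apply/negP => u3.
have := gaps0 u (mem_index_enum u); rewrite uu0 /= => /eqP gapu.
by have := secant_gap_gt0 R g _ scf u3; rewrite gapu ltxx.
Qed.
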